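(* The elliptic curve over $\mathbb{Q}$ $$\begin{aligned}Y^2+XY=X^3&-37680956700999226080263982005713090640\,X\\&-36992898397926078743894505902555362159162611772488902400\end{aligned}$$ is induced by a rational Diophantine triple. In fact, it is induced by each of the rational Diophantine triples $$\left\{\frac{31269599}{31628160},\ -\frac{23721120}{31269599},\ \frac{1461969791}{7144352640}\right\}$$ and $$\left\{\frac{7567037280}{7833785281},\ \frac{4161669360289}{569762123040},\ \frac{1359453258559}{948852707040}\right\}.$$
   Context: A set $\{c_1,c_2,c_3\}$ of non-zero rationals is a rational Diophantine triple if $c_ic_j+1$ is the square of a rational number for all $1\le i<j\le 3$. An elliptic curve over $\mathbb{Q}$ is said to be induced by $\{c_1,c_2,c_3\}$ if it is isomorphic over $\mathbb{Q}$ to the curve $y^2=(c_1x+1)(c_2x+1)(c_3x+1)$. (The displayed curve is the curve found by Elkies with torsion group $\mathbb{Z}/2\mathbb{Z}\times\mathbb{Z}/6\mathbb{Z}$ and rank $6$ over $\mathbb{Q}$.) *)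

(* Defs.v *)
From HB Require Import structures.
From mathcomp Require Import all_boot all_order all_algebra all_field.
From mathcomp Require Export mpoly.

Set Implicit Arguments.
Unset Strict Implicit.
Unset Printing Implicit Defensive.

Import GRing.Theory.
Local Open Scope ring_scope.

(* The projective plane over algC (an algebraic closure of rat): a point is   *)
(* given by a nonzero vector of homogeneous coordinates (x : y : z), two      *)
(* vectors giving the same point when they are proportional.                  *)
Definition same_point (P Q : 'rV[algC]_3) : Prop :=
  exists2 k : algC, k != 0 & Q = k *: P.

Definition evalC (F : {mpoly rat[3]}) (P : 'rV[algC]_3) : algC :=
  (map_mpoly (ratr : rat -> algC) F).@[P 0].

Definition on_curve (F : {mpoly rat[3]}) (P : 'rV[algC]_3) : Prop :=
  P != 0 /\ evalC F P = 0.

(* A plane projective curve over rat with a marked point. *)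
Record pointed_curve := PointedCurve {
  equation : {mpoly rat[3]};
  origin : 'rV[rat]_3
}.

Definition originC (E : pointed_curve) : 'rV[algC]_3 := map_mx ratr (origin E).

(* Elliptic curves over rat are presented as plane cubics that are smooth at  *)
(* every geometric point, with a rational point as origin. A zero equation is *)
(* excluded by smoothness.                                                    *)
Definition is_elliptic_curve (E : pointed_curve) : Prop :=
  [/\ equation E \is 3.-homog,
      on_curve (equation E) (originC E) &
      forall P, on_curve (equation E) P ->
        exists i : 'I_3, evalC (equation E)^`M(i) P != 0].

(* Morphisms over rat, in the sense of varieties: near each geometric point   *)
(* the map is given by a triple of forms of equal degree with rational        *)
(* coefficients, without common zero at that point. The condition forces phi  *)
(* to send proportional coordinate vectors of C to proportional ones. The     *)
(* degree and the forms may depend on P.                                      *)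
Definition is_morphism (C D : {mpoly rat[3]})
    (phi : 'rV[algC]_3 -> 'rV[algC]_3) : Prop :=
  forall P, on_curve C P ->
    on_curve D (phi P) /\
    exists (d : nat) (f : 'I_3 -> {mpoly rat[3]}),
      [/\ forall i, f i \is d.-homog,
          \row_i evalC (f i) P != 0 &
          forall Q, on_curve C Q -> \row_i evalC (f i) Q != 0 ->
            same_point (phi Q) (\row_i evalC (f i) Q)].

(* Isomorphism of elliptic curves over rat: an isomorphism of varieties over  *)
(* rat that matches the origins.                                              *)
Definition isomorphic_over_rat (E E' : pointed_curve) : Prop :=
  exists phi psi : 'rV[algC]_3 -> 'rV[algC]_3,
    [/\ is_morphism (equation E) (equation E') phi,
        is_morphism (equation E') (equation E) psi,
        forall P, on_curve (equation E) P -> same_point (psi (phi P)) P,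
        forall P, on_curve (equation E') P -> same_point (phi (psi P)) P &
        same_point (phi (originC E)) (originC E')].

Definition x : {mpoly rat[3]} := 'X_0.
Definition y : {mpoly rat[3]} := 'X_1.
Definition z : {mpoly rat[3]} := 'X_2.

(* (0 : 1 : 0) *)
Definition infinity : 'rV[rat]_3 := delta_mx 0 1.

(* Projective closure of Y^2 + a1 XY + a3 Y = X^3 + a2 X^2 + a4 X + a6. *)
Definition weierstrass_curve (a1 a2 a3 a4 a6 : rat) : pointed_curve :=
  PointedCurve
    (y ^+ 2 * z + a1 *: (x * y * z) + a3 *: (y * z ^+ 2)
     - (x ^+ 3 + a2 *: (x ^+ 2 * z) + a4 *: (x * z ^+ 2) + a6 *: z ^+ 3))
    infinity.

(* Projective closure of y^2 = (c1 x + 1)(c2 x + 1)(c3 x + 1); for nonzero    *)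
(* c1, c2, c3 its only point at infinity is (0 : 1 : 0).                      *)
Definition triple_curve (c1 c2 c3 : rat) : pointed_curve :=
  PointedCurve
    (y ^+ 2 * z - (c1 *: x + z) * (c2 *: x + z) * (c3 *: x + z))
    infinity.

Definition is_rat_square (q : rat) : Prop := exists r : rat, q = r ^+ 2.

(* The entries are pairwise distinct because a triple is a set {c1, c2, c3}. *)
Definition rational_diophantine_triple (c : rat * rat * rat) : Prop :=
  let: (c1, c2, c3) := c in
  [/\ [/\ c1 != c2, c1 != c3 & c2 != c3],
      [/\ c1 != 0, c2 != 0 & c3 != 0] &
      [/\ is_rat_square (c1 * c2 + 1), is_rat_square (c1 * c3 + 1) &
          is_rat_square (c2 * c3 + 1)]].

Definition induced_by (E : pointed_curve) (c : rat * rat * rat) : Prop :=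
  let: (c1, c2, c3) := c in isomorphic_over_rat E (triple_curve c1 c2 c3).

(* The numerals below are nat literals cast by %:R: a bare numeral of this    *)
(* size in ring_scope would be expanded in unary.                             *)

(* Y^2 + XY = X^3 - 37680956700999226080263982005713090640 X                  *)
(*   - 36992898397926078743894505902555362159162611772488902400               *)
Definition elkies_curve : pointed_curve :=
  weierstrass_curve 1 0 0
    (- 37680956700999226080263982005713090640%:R)
    (- 36992898397926078743894505902555362159162611772488902400%:R).

Definition triple1 : rat * rat * rat :=
  (31269599%:R / 31628160%:R,
   - (23721120%:R / 31269599%:R),
   1461969791%:R / 7144352640%:R).

Definition triple2 : rat * rat * rat :=
  (7567037280%:R / 7833785281%:R,
   4161669360289%:R / 569762123040%:R,
   1359453258559%:R / 948852707040%:R).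

(* Main.v *)
Require Import Defs.
From mathcomp Require Import all_boot all_order all_algebra all_field.
From mathcomp Require Import ring lra.

(* The isomorphisms with the curves induced by the two triples are affine     *)
(* changes of variables: after completing the square on the left,             *)
(*   X = u^2 s x + r,  Y + (a1 X + a3) / 2 = u^3 s y,  s = c1 c2 c3,          *)
(* carries one cubic to the other as soon as three equations between rational *)
(* numbers hold; u and r are found by matching the coefficients of the two    *)
(* cubics. Projectively this is a linear change of coordinates.               *)

Set Implicit Arguments.
Unset Strict Implicit.
Unset Printing Implicit Defensive.

Import Order.TTheory GRing.Theory Num.Theory.
Local Open Scope ring_scope.

(** Both curves are plane cubics with the flex (0 : 1 : 0) as origin, so an invertible linear change
    of coordinates that fixes this point and carries one equation to a multiple of the other is an
    isomorphism ([linear_isomorphism]). Comparing the two cubics reduces its existence to three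
    equations in u and r ([weierstrass_triple_isomorphism]). What remains is exact arithmetic: a
    non-zero discriminant gives smoothness ([weierstrass_elliptic]), explicit square roots give the
    Diophantine property, and one pair (u, r) per triple gives the isomorphism. *)

Lemma big_ord3 (V : nmodType) (F : 'I_3 -> V) : \sum_i F i = F 0 + F 1 + F 2.
Proof.
rewrite !big_ord_recl big_ord0 addr0 addrA.
by do ![congr (_ + _)]; congr F; apply: val_inj.
Qed.

(** * Evaluation and differentiation of forms *)

Lemma evalCX i P : evalC 'X_i P = P 0 i.
Proof. by rewrite /evalC map_mpolyX mevalXU. Qed.

Lemma evalCZ a F P : evalC (a *: F) P = ratr a * evalC F P.
Proof. by rewrite /evalC map_mpolyZ mevalZ. Qed.

Lemma evalCD P : {morph evalC^~ P : F G / F + G}.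
Proof. by move=> F G; rewrite /evalC !rmorphD. Qed.

Lemma evalCN P : {morph evalC^~ P : F / - F}.
Proof. by move=> F; rewrite /evalC !rmorphN. Qed.

Lemma evalCM P : {morph evalC^~ P : F G / F * G}.
Proof. by move=> F G; rewrite /evalC !rmorphM. Qed.

Lemma evalCXn n P : {morph evalC^~ P : F / F ^+ n}.
Proof. by move=> F; rewrite /evalC !rmorphXn. Qed.

Lemma evalC_sum I (r : seq I) (F : I -> {mpoly rat[3]}) P :
  evalC (\sum_(i <- r) F i) P = \sum_(i <- r) evalC (F i) P.
Proof.
by rewrite /evalC (rmorph_sum (map_mpoly ratr)) (rmorph_sum (meval (P 0))).
Qed.

Lemma evalC0 P : evalC 0 P = 0.
Proof. by rewrite /evalC !rmorph0. Qed.

Lemma evalC1 P : evalC 1 P = 1.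
Proof. by rewrite /evalC !rmorph1. Qed.

Lemma mderivU n (R : nzRingType) (i j : 'I_n) :
  ('X_i : {mpoly R[n]})^`M(j) = (i == j)%:R.
Proof.
rewrite mderivX mnm1E; have [->|_] := eqVneq i j; last by rewrite scale0r.
have -> : (U_(j) - U_(j) = 0)%MM by apply/mnmP=> k; rewrite !mnmE subnn.
by rewrite mpolyX0 scale1r.
Qed.

Definition evalCE :=
  (evalCD, evalCN, evalCM, evalCXn, evalCZ, evalCX, evalC0, evalC1).
Definition mderivE := (mderivD, mderivN, mderivM, mderivZ, mderivU).

Lemma dhomogU n (R : nzRingType) (i : 'I_n) :
  ('X_i : {mpoly R[n]}) \is 1.-homog.
Proof. by rewrite dhomogX /= mdeg1. Qed.

(** One triple of linear forms defines the map everywhere, and invertibility keeps the forms from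
    vanishing together. [A] goes from [E'] to [E], so the forward map is multiplication by its
    inverse. *)
Lemma linear_isomorphism (E E' : pointed_curve) (A : 'M[rat]_3) (k l : rat) :
  \det A != 0 -> k != 0 -> l != 0 ->
  (forall P, evalC (equation E) (P *m map_mx ratr A) =
             ratr k * evalC (equation E') P) ->
  origin E' *m A = l *: origin E ->
  isomorphic_over_rat E E'.
Proof.
move=> detA k0 l0 eqA oA.
have uA : A \in unitmx by rewrite unitmxE unitfE.
pose AC : 'M[algC]_3 := map_mx ratr A.
pose BC : 'M[algC]_3 := map_mx ratr (invmx A).
have ABC : AC *m BC = 1%:M by rewrite -map_mxM mulmxV // map_mx1.
have BAC : BC *m AC = 1%:M by rewrite -map_mxM mulVmx // map_mx1.
have neq0 (M N : 'M[algC]_3) (P : 'rV_3) :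
    M *m N = 1%:M -> P != 0 -> P *m M != 0.
  move=> MN; apply: contraNneq => PM.
  by rewrite -[P]mulmx1 -MN mulmxA PM mul0mx eqxx.
have linE (M : 'M[rat]_3) P :
    \row_i evalC (\sum_j M j i *: 'X_j) P = P *m map_mx ratr M.
  apply/rowP=> i; rewrite !mxE evalC_sum; apply: eq_bigr => j _.
  by rewrite evalCZ evalCX mxE mulrC.
have lin_morph C D (M N : 'M[rat]_3) :
    map_mx ratr M *m map_mx ratr N = 1%:M :> 'M[algC]_3 ->
    (forall P, evalC C P = 0 -> evalC D (P *m map_mx ratr M) = 0) ->
    is_morphism C D (fun P => P *m map_mx ratr M).
  move=> MN CD P [P0 CP]; split.
    by split; [apply: (neq0 _ _ _ MN P0) | apply: CD].
  exists 1%N, (fun i => \sum_j M j i *: 'X_j); split.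
  - by move=> i; apply: rpred_sum => j _; apply/rpredZ/dhomogU.
  - by rewrite linE; apply: (neq0 _ _ _ MN P0).
  - by move=> Q _ _; rewrite linE; exists 1; rewrite ?oner_neq0 ?scale1r.
exists (fun P => P *m BC), (fun P => P *m AC); split.
- apply: (lin_morph _ _ _ _ BAC) => P.
  rewrite -{1}[P]mulmx1 -BAC mulmxA eqA => /eqP.
  by rewrite mulf_eq0 fmorph_eq0 (negPf k0) => /eqP.
- by apply: (lin_morph _ _ _ _ ABC) => P CP; rewrite eqA CP mulr0.
- by move=> P _; exists 1; rewrite ?oner_neq0 // -mulmxA BAC mulmx1 scale1r.
- by move=> P _; exists 1; rewrite ?oner_neq0 // -mulmxA ABC mulmx1 scale1r.
exists (ratr l); first by rewrite fmorph_eq0.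
by rewrite -map_mxM -map_mxZ scalemxAl -oA mulmxK.
Qed.

(** * Smoothness from the discriminant *)

Section Weierstrass.
Variables (R : comPzRingType) (a1 a2 a3 a4 a6 : R).

Definition weierstrass_b2 := a1 ^+ 2 + 4 * a2.
Definition weierstrass_b4 := 2 * a4 + a1 * a3.
Definition weierstrass_b6 := a3 ^+ 2 + 4 * a6.
Definition weierstrass_b8 :=
  a1 ^+ 2 * a6 + 4 * a2 * a6 - a1 * a3 * a4 + a2 * a3 ^+ 2 - a4 ^+ 2.
Definition weierstrass_disc :=
  - weierstrass_b2 ^+ 2 * weierstrass_b8 - 8 * weierstrass_b4 ^+ 3
  - 27 * weierstrass_b6 ^+ 2
  + 9 * weierstrass_b2 * weierstrass_b4 * weierstrass_b6.

End Weierstrass.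

Lemma weierstrass_singular_disc
    (R : comPzRingType) (a1 a2 a3 a4 a6 X Y : R) :
  Y ^+ 2 + a1 * X * Y + a3 * Y - (X ^+ 3 + a2 * X ^+ 2 + a4 * X + a6) = 0 ->
  a1 * Y - (3 * X ^+ 2 + 2 * a2 * X + a4) = 0 ->
  2 * Y + a1 * X + a3 = 0 ->
  weierstrass_disc a1 a2 a3 a4 a6 = 0.
Proof.
move=> F0 FX0 FY0.
set F := (X in X = 0) in F0; set FX := (X in X = 0) in FX0.
set FY := (X in X = 0) in FY0.
pose b2 := weierstrass_b2 a1 a2; pose b4 := weierstrass_b4 a1 a3 a4.
pose b6 := weierstrass_b6 a3 a6; pose b8 := weierstrass_b8 a1 a2 a3 a4 a6.
(* psi is the square of the 2-division polynomial and phi / psi is the        *)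
(* x-coordinate of the double of a point; the discriminant is a combination   *)
(* of phi and psi.                                                            *)
pose psi := 4 * X ^+ 3 + b2 * X ^+ 2 + 2 * b4 * X + b6.
pose phi := X ^+ 4 - b4 * X ^+ 2 - 2 * b6 * X - b8.
have psi0 : psi = 0.
  transitivity (FY ^+ 2 - 4 * F); last by rewrite F0 FY0; ring.
  rewrite /psi /FY /F /b2 /b4 /b6 /weierstrass_b2 /weierstrass_b4.
  by rewrite /weierstrass_b6; ring.
have phi0 : phi = 0.
  (* With tangent slope t = - FX / FY, the first three terms are FY^2 times t^2 + a1 t - a2 - 2 X,
     the duplication formula; the multiple of F accounts for points off the curve. *)
  transitivity (FX ^+ 2 - a1 * FX * FY - (a2 + 2 * X) * FY ^+ 2
                + (b2 + 8 * X) * F); last by rewrite F0 FX0 FY0; ring.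
  rewrite /phi /FX /FY /F /b2 /b4 /b6 /b8 /weierstrass_b2 /weierstrass_b4.
  by rewrite /weierstrass_b6 /weierstrass_b8; ring.
transitivity
  ((12 * X ^+ 3 - b2 * X ^+ 2 - 10 * b4 * X + b2 * b4 - 27 * b6) * psi
   - (48 * X ^+ 2 + 8 * b2 * X + 32 * b4 - b2 ^+ 2) * phi).
  rewrite /weierstrass_disc /psi /phi /b2 /b4 /b6 /b8.
  rewrite /weierstrass_b2 /weierstrass_b4 /weierstrass_b6 /weierstrass_b8.
  by ring.
by rewrite psi0 phi0 !mulr0 subr0.
Qed.

Lemma rmorph_weierstrass_disc (R S : comNzRingType) (f : {rmorphism R -> S})
    (a1 a2 a3 a4 a6 : R) :
  f (weierstrass_disc a1 a2 a3 a4 a6) =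
  weierstrass_disc (f a1) (f a2) (f a3) (f a4) (f a6).
Proof.
rewrite /weierstrass_disc /weierstrass_b2 /weierstrass_b4 /weierstrass_b6.
by rewrite /weierstrass_b8; ring.
Qed.

Lemma weierstrass_homog (a1 a2 a3 a4 a6 : rat) :
  equation (weierstrass_curve a1 a2 a3 a4 a6) \is 3.-homog.
Proof.
have hU i : ('X_i : {mpoly rat[3]}) \is 1.-homog by apply: dhomogU.
have hU2 i : ('X_i : {mpoly rat[3]}) ^+ 2 \is 2.-homog.
  exact: (dhomogMn _ (hU i)).
have hU3 i : ('X_i : {mpoly rat[3]}) ^+ 3 \is 3.-homog.
  exact: (dhomogMn _ (hU i)).
have h11 i j : ('X_i * 'X_j : {mpoly rat[3]}) \is 2.-homog.
  exact: (dhomogM (hU i) (hU j)).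
have h21 p i : p \is 2.-homog -> (p * 'X_i : {mpoly rat[3]}) \is 3.-homog.
  by move=> hp; exact: (dhomogM hp (hU i)).
have h12 p i : p \is 2.-homog -> ('X_i * p : {mpoly rat[3]}) \is 3.-homog.
  by move=> hp; exact: (dhomogM (hU i) hp).
by rewrite /= /x /y /z !(rpredB, rpredD, rpredZ) ?h21 ?h12 ?hU2 ?h11.
Qed.

Lemma weierstrass_elliptic (a1 a2 a3 a4 a6 : rat) :
  weierstrass_disc a1 a2 a3 a4 a6 != 0 ->
  is_elliptic_curve (weierstrass_curve a1 a2 a3 a4 a6).
Proof.
move=> D0; split; first exact: weierstrass_homog.
  split.
    apply/eqP => /rowP /(_ 1); rewrite !mxE rmorph1 => /eqP.
    by rewrite oner_eq0.
  by rewrite /= /x /y /z !evalCE !mxE /= !rmorph0 rmorph1; ring.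
move=> P [P0] /=; rewrite /x /y /z !evalCE => F0.
have [Z0|Z0] := eqVneq (P 0 2) 0.
  (* On z = 0 the cubic is - x^3, which leaves only (0 : 1 : 0); there the z-partial is y^2. *)
  have X0 : P 0 0 = 0.
    have : P 0 0 ^+ 3 = 0 by rewrite -[RHS]oppr0 -F0 Z0; ring.
    by move/eqP; rewrite expf_eq0 => /eqP.
  have Y0 : P 0 1 != 0.
    apply: contraNneq P0 => Y0; apply/eqP/rowP => i; rewrite mxE.
    by case: i => [[|[|[|//]]] iP]; [rewrite -X0|rewrite -Y0|rewrite -Z0];
      congr (P 0 _); apply: val_inj.
  exists 2; rewrite /= /x /y /z !mderivE !evalCE /= X0 Z0.
  by rewrite [X in X != 0](_ : _ = P 0 1 ^+ 2) ?expf_neq0 //; ring.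
(* At an affine point the x- and y-partials suffice: if both vanished, dividing by powers of z would
   give an affine singular point, hence discriminant zero. *)
pose F := equation (weierstrass_curve a1 a2 a3 a4 a6).
have [FX0|] := eqVneq (evalC F^`M(0) P) 0; last by exists 0.
have [FY0|] := eqVneq (evalC F^`M(1) P) 0; last by exists 1.
move: FX0 FY0; rewrite /F /= /x /y /z !mderivE !evalCE /= => FX0 FY0.
case/eqP: D0; apply/eqP; rewrite -(fmorph_eq0 (ratr : {rmorphism rat -> algC})).
rewrite rmorph_weierstrass_disc; apply/eqP.
apply: (@weierstrass_singular_disc _ _ _ _ _ _ (P 0 0 / P 0 2) (P 0 1 / P 0 2)).
- by rewrite -[RHS](mul0r (P 0 2 ^- 3)) -F0; field.
- by rewrite -[RHS](mul0r (P 0 2 ^- 2)) -FX0; field.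
- by rewrite -[RHS](mul0r (P 0 2 ^- 2)) -FY0; field.
Qed.

(** * Changes of variables to curves of triples *)

(* Acts on row vectors (x, y, z) from the right. *)
Definition triple_change (a1 a3 s u r : rat) : 'M[rat]_3 :=
  \matrix_(i, j) nth 0 (nth [::]
    [:: [:: u ^+ 2 * s; - (a1 * u ^+ 2 * s / 2); 0];
        [:: 0; u ^+ 3 * s; 0];
        [:: r; - ((a1 * r + a3) / 2); 1]] i) j.

Lemma det_triple_change (a1 a3 s u r : rat) :
  \det (triple_change a1 a3 s u r) = u ^+ 5 * s ^+ 2.
Proof.
rewrite (expand_det_col _ 2) !big_ord_recl big_ord0 /cofactor.
rewrite !(expand_det_row _ 0) !big_ord_recl !big_ord0 /cofactor.
by rewrite !det_mx11 !mxE /=; ring.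
Qed.

(** The completed square reads 4 (Y + (a1 X + a3) / 2)^2 = 4 X^3 + b2 X^2 + 2 b4 X + b6. The factor
    s makes the leading terms agree; the hypotheses match the coefficients of x^2, x and 1, the
    first two after cancelling u^4 s^2 and 2 u^2 s. *)
Lemma weierstrass_triple_isomorphism (a1 a2 a3 a4 a6 c1 c2 c3 u r : rat) :
  let s := c1 * c2 * c3 in
  u != 0 -> c1 != 0 -> c2 != 0 -> c3 != 0 ->
  weierstrass_b2 a1 a2 + 12 * r = 4 * u ^+ 2 * (c1 * c2 + c1 * c3 + c2 * c3) ->
  weierstrass_b4 a1 a3 a4 + weierstrass_b2 a1 a2 * r + 6 * r ^+ 2 =
    2 * u ^+ 4 * (s * (c1 + c2 + c3)) ->
  weierstrass_b6 a3 a6 + 2 * weierstrass_b4 a1 a3 a4 * r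
    + weierstrass_b2 a1 a2 * r ^+ 2 + 4 * r ^+ 3 = 4 * u ^+ 6 * s ^+ 2 ->
  isomorphic_over_rat
    (weierstrass_curve a1 a2 a3 a4 a6) (triple_curve c1 c2 c3).
Proof.
move=> s u0 c10 c20 c30 e2 e4 e6.
have s0 : s != 0 by rewrite !mulf_neq0.
apply: (@linear_isomorphism _ _ (triple_change a1 a3 s u r)
  (u ^+ 6 * s ^+ 2) (u ^+ 3 * s)).
- by rewrite det_triple_change mulf_neq0 ?expf_neq0.
- by rewrite mulf_neq0 ?expf_neq0.
- by rewrite mulf_neq0 ?expf_neq0.
- have ratr0 p q : p = q -> ratr (p - q) = 0 :> algC.
    by move=> ->; rewrite subrr rmorph0.
  move/ratr0: e2 => e2; move/ratr0: e4 => e4; move/ratr0: e6 => e6.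
  move=> P; rewrite /= /x /y /z !evalCE !mxE !big_ord3 !mxE /=.
  apply/eqP; rewrite -subr_eq0; apply/eqP.
  set d2 := (X in X = 0) in e2; set d4 := (X in X = 0) in e4.
  set d6 := (X in X = 0) in e6.
  (* The weights restore the cancelled factors. *)
  transitivity (- (ratr (u ^+ 4 * s ^+ 2) * P 0 0 ^+ 2 * P 0 2 * d2
     + 2 * ratr (u ^+ 2 * s) * P 0 0 * P 0 2 ^+ 2 * d4 + P 0 2 ^+ 3 * d6) / 4).
    rewrite /d2 /d4 /d6 /s /weierstrass_b2 /weierstrass_b4 /weierstrass_b6.
    by field.
  by rewrite e2 e4 e6 !mulr0 !addr0 oppr0 mul0r.
apply/rowP => -[[|[|[|//]]] i].
all: by rewrite !mxE big_ord3 !mxE /s /=; ring.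
Qed.

(** * The Elkies curve and its two triples *)

Lemma elkies_curve_elliptic : is_elliptic_curve elkies_curve.
Proof.
(* The discriminant is positive, a numerical inequality that [lra] decides. *)
apply: weierstrass_elliptic; apply: negbT; apply: gt_eqF.
rewrite /weierstrass_disc /weierstrass_b2 /weierstrass_b4 /weierstrass_b6.
by rewrite /weierstrass_b8; lra.
Qed.

Lemma triple1_diophantine : rational_diophantine_triple triple1.
Proof.
split.
- split.
  + by apply: negbT; apply: gt_eqF; lra.
  + by apply: negbT; apply: gt_eqF; lra.
  + by apply: negbT; apply: lt_eqF; lra.
- split.
  + by apply: negbT; apply: gt_eqF; lra.
  + by apply: negbT; apply: lt_eqF; lra.
  + by apply: negbT; apply: gt_eqF; lra.
- split.
  + by exists (1 / 2%:R); field.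
  + by exists (120001%:R / 109440%:R); field.
  + by exists (120001%:R / 130562%:R); field.
Qed.

Lemma elkies_curve_induced_by_triple1 : induced_by elkies_curve triple1.
Proof.
(* The points x = - 1 / c_i go to the 2-torsion abscissae e_i = r - u^2 c_j c_k. Hence u^2 = (e_i -
   e_j) / (c_k (c_i - c_j)), and r follows; the sign of u is free. *)
apply: (@weierstrass_triple_isomorphism _ _ _ _ _ _ _ _
  3572176320%:R (- 2989863404519469920%:R)).
- by apply: negbT; apply: gt_eqF; lra.
- by apply: negbT; apply: gt_eqF; lra.
- by apply: negbT; apply: lt_eqF; lra.
- by apply: negbT; apply: gt_eqF; lra.
- by rewrite /weierstrass_b2; field.
- by rewrite /weierstrass_b2 /weierstrass_b4; field.
- by rewrite /weierstrass_b2 /weierstrass_b4 /weierstrass_b6; field.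
Qed.

Lemma triple2_diophantine : rational_diophantine_triple triple2.
Proof.
split.
- split.
  + by apply: negbT; apply: lt_eqF; lra.
  + by apply: negbT; apply: lt_eqF; lra.
  + by apply: negbT; apply: gt_eqF; lra.
- split.
  + by apply: negbT; apply: gt_eqF; lra.
  + by apply: negbT; apply: gt_eqF; lra.
  + by apply: negbT; apply: gt_eqF; lra.
- split.
  + by exists (185282%:R / 65281%:R); field.
  + by exists (185282%:R / 120001%:R); field.
  + by exists (92641%:R / 27360%:R); field.
Qed.

Lemma elkies_curve_induced_by_triple2 : induced_by elkies_curve triple2.
Proof.
(* Found in the same way; 8582354881 is 92641^2. *)
apply: (@weierstrass_triple_isomorphism _ _ _ _ _ _ _ _
  (107166182644080%:R / 92641%:R)
  (72369996453351802953867928480%:R / 8582354881%:R)).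
- by apply: negbT; apply: gt_eqF; lra.
- by apply: negbT; apply: gt_eqF; lra.
- by apply: negbT; apply: gt_eqF; lra.
- by apply: negbT; apply: gt_eqF; lra.
- by rewrite /weierstrass_b2; field.
- by rewrite /weierstrass_b2 /weierstrass_b4; field.
- by rewrite /weierstrass_b2 /weierstrass_b4 /weierstrass_b6; field.
Qed.

Theorem mainTheorem7 :
  is_elliptic_curve elkies_curve /\
  (exists c : rat * rat * rat,
     rational_diophantine_triple c /\ induced_by elkies_curve c) /\
  (rational_diophantine_triple triple1 /\ induced_by elkies_curve triple1) /\
  (rational_diophantine_triple triple2 /\ induced_by elkies_curve triple2).
Proof.
split; first exact: elkies_curve_elliptic.
split.
  exists triple1; split; first exact: triple1_diophantine.
  exact: elkies_curve_induced_by_triple1.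
split; split.
- exact: triple1_diophantine.
- exact: elkies_curve_induced_by_triple1.
- exact: triple2_diophantine.
- exact: elkies_curve_induced_by_triple2.
Qed.
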